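(* Let $N\ge2$, $\lambda>0$, $p>0$, $\alpha>-2$ and $F\ne0$. Suppose $u=u(r)$, $r=|x|$, is a positive radial rupture solution of $$\Delta u=\frac{\lambda|x|^{\alpha}}{u^{p}}+F\ \text{ in }\mathbb{R}^N\setminus\{0\},\qquad u>0\text{ in }\mathbb{R}^N\setminus\{0\},\qquad u(0)=0,$$ and assume there exists $\varepsilon>0$ such that $$u(r)=\Lambda r^{\frac{\alpha+2}{p+1}}\bigl(1+O(r^{\varepsilon})\bigr)\quad\text{as }r\to0^+,$$ where $\Lambda=\left(\frac{\lambda}{\frac{\alpha+2}{p+1}\left(\frac{\alpha+2}{p+1}+N-2\right)}\right)^{\frac1{p+1}}$. Set $t=\ln r$, $z(t)=r^{-\frac{\alpha+2}{p+1}}u(r)-\Lambda$ and $\rho=\frac{2p-\alpha}{p+1}$. Then there are constants $c_\ell$ such that for every sufficiently large integer $k$, $$z(t)=\sum_{\ell=1}^{k}c_\ell e^{\ell\rho t}+O\bigl(e^{(k+1)\rho t}\bigr)\quad\text{as }t\to-\infty.$$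
   Context: A rupture solution is a continuous function $u$ on $\mathbb{R}^N$ with $u(0)=0$, $u>0$ and $u$ of class $C^2$ on $\mathbb{R}^N\setminus\{0\}$, satisfying the equation pointwise there. *)

(* Defs.v *)
From HB Require Import structures.
From mathcomp Require Import all_boot all_order all_algebra.
From mathcomp Require Import all_classical all_reals all_analysis.
Set Implicit Arguments.
Unset Strict Implicit.
Unset Printing Implicit Defensive.
Import Order.TTheory GRing.Theory Num.Theory.
Import numFieldNormedType.Exports.
Local Open Scope classical_set_scope.
Local Open Scope ring_scope.

(* The library norm on ['rV[R]_N] is the sup norm: it gives the right topology,
   but |x| in the equation has to be the Euclidean norm. *)
Definition enorm (R : realType) (N : nat) (x : 'rV[R]_N) : R :=
  Num.sqrt (\sum_(i < N) x 0 i ^+ 2).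

Definition partial (R : realType) (N : nat) (i : 'I_N) (u : 'rV[R]_N -> R) :
  'rV[R]_N -> R := 'D_(delta_mx 0 i) u.

Definition laplacian (R : realType) (N : nat) (u : 'rV[R]_N -> R)
  (x : 'rV[R]_N) : R := \sum_(i < N) partial i (partial i u) x.

(* ['D_v] is total, so the existence of the partial derivatives is required
   separately from their continuity. *)
Definition C2_on (R : realType) (N : nat) (A : set 'rV[R]_N)
    (u : 'rV[R]_N -> R) : Prop :=
  forall x, A x ->
    {for x, continuous u} /\
    (forall i : 'I_N,
      derivable u x (delta_mx 0 i) /\ {for x, continuous (partial i u)}) /\
    (forall i j : 'I_N,
      derivable (partial i u) x (delta_mx 0 j) /\
      {for x, continuous (partial j (partial i u))}).

Definition rupture_solution (R : realType) (N : nat) (lambda alpha p F : R)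
    (u : 'rV[R]_N -> R) : Prop :=
  [/\ continuous u,
      u 0 = 0,
      forall x, x != 0 -> 0 < u x,
      C2_on [set x | x != 0] u &
      forall x, x != 0 ->
        laplacian u x = lambda * enorm x `^ alpha / u x `^ p + F].

(* The landau notations need the filter [t --> -oo] bundled with its proof of
   being a filter; the library does not do it. *)
Canonical ninfty_filter_on (R : numFieldType) : filter_on R :=
  FilterType (ninfty_nbhs R) _.

(* Main.v *)
Require Import Defs.
From HB Require Import structures.
From mathcomp Require Import all_boot all_order all_algebra.
From mathcomp Require Import all_classical all_reals all_analysis.
From mathcomp Require Import ring lra.
Import Order.TTheory GRing.Theory Num.Theory.
Import numFieldNormedType.Exports.
Local Open Scope classical_set_scope.
Local Open Scope ring_scope.

(** In the variables [t = ln r] and [1 + y = r^(-m) u / Lambda] the radial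
    equation becomes autonomous up to one exponential,
      [y'' + a y' + q y = b gam(y) + (F / Lambda) e^(rho t)],
    with [a = 2m + N - 2 > 0], [b = m (m + N - 2) > 0], [q = (p + 1) b > 0] and
    [gam(x) = (1 + x)^(-p) - 1 + p x], which is smooth and vanishes to second
    order at 0 ([radial_ode], [emden_fowler], [scaled_equation]).  The
    assumption on [u] says that [y] tends to 0 at [-oo].

    Suppose [rho > 0] and put [x = e^(rho t)].  The characteristic polynomial
    [mu^2 + a mu + q] is positive at every [mu = l rho], so there is no
    resonance: the coefficients of a formal solution [S(x) = sum c_l x^l] can be
    determined one after the other, each killing the leading term of the
    residual left by its predecessors ([next_coefficient], [formal_solution]).
    Both characteristic roots have negative real part, hence solutions of the
    homogeneous equation blow up at [-oo] and a bounded solution is controlled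
    by the forcing term.  This is proved by an energy estimate which also absorbs
    a small multiple of the unknown ([energy_decay]).  The difference [d] between
    [y] and the truncated sum [S_k] satisfies the linear equation with forcing
    [b (gam(y) - gam(S_k)) = o(|d|)] plus a residual [O(x^(k+1))], so that
    [d = O(x^(k+1))] at once, for every [k] ([asymptotic_expansion]).

    If [rho <= 0] there is no such [u].  In that case [F e^(rho t)] does not
    tend to 0, so [y'' + a y'] is bounded away from 0 with a constant sign near
    [-oo]; then [y' + a y] is unbounded, which a bounded [y] does not allow
    ([no_bounded_solution], [no_solution_nonpos_rho]).  This is where [F != 0]
    is used. *)

Set Implicit Arguments.
Unset Strict Implicit.

(** * Second order linear equations near minus infinity *)

Lemma is_derive_expRM (R : realType) (a t : R) :
  is_derive t (1 : R) (fun x => expR (a * x)) (a * expR (a * t)).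
Proof. by apply: is_derive_eq; rewrite /GRing.scale /=; ring. Qed.

Lemma mvt_below (R : realType) (T : R) (f df : R -> R) (s t : R) :
  (forall x, x < T -> is_derive x (1 : R) f (df x)) -> s < t -> t < T ->
  exists2 c, s < c < t & f t - f s = df c * (t - s).
Proof.
move=> Df st tT.
have [||c] := @MVT R f df s t st; last by rewrite in_itv /= => cst ->; exists c.
- by move=> x; rewrite in_itv /= => /andP[_ xt]; apply/Df/(lt_trans xt).
- apply: derivable_within_continuous => x; rewrite in_itv /= => /andP[_ xt].
  by have := Df x (le_lt_trans xt tT) => -[].
Qed.

(** On each interval of length 1 the mean value theorem gives a point where
    [y'] is at most [2 M]; since [(e^(a t) y')' = e^(a t) (y'' + a y')], this
    bound propagates to the right end of the interval. *)
Lemma bounded_derivative (R : realType) (T a M C : R) (y y1 y2 : R -> R) :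
  0 < a ->
  (forall t, t < T -> is_derive t (1 : R) y (y1 t)) ->
  (forall t, t < T -> is_derive t (1 : R) y1 (y2 t)) ->
  (forall t, t < T -> `|y t| <= M) ->
  (forall t, t < T -> `|y2 t + a * y1 t| <= C) ->
  forall t, t < T -> `|y1 t| <= 2 * M + C.
Proof.
move=> a0 Dy Dy1 yM yC t tT.
have t1 : t - 1 < t by lra.
have [s /andP[s1 st] ys] := mvt_below Dy t1 tT.
have y1s : `|y1 s| <= 2 * M.
  have -> : y1 s = y t - y (t - 1) by rewrite ys; ring.
  have := yM _ tT; have := yM _ (lt_trans t1 tT).
  by have := ler_normB (y t) (y (t - 1)); lra.
pose k x := expR (a * x) * y1 x.
pose dk x := expR (a * x) * (y2 x + a * y1 x).
have Dk x : x < T -> is_derive x (1 : R) k (dk x).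
  move=> xT; have Dx := Dy1 _ xT.
  have De := is_derive_expRM a x.
  apply: is_derive_eq.
  by rewrite /dk /GRing.scale /=; ring.
have [xi /andP[sx xt] kE] := mvt_below Dk st tT.
have C0 : 0 <= C by rewrite (le_trans _ (yC _ tT)).
have kt : `|k t| <= expR (a * t) * (2 * M + C).
  have -> : k t = k s + dk xi * (t - s) by rewrite -kE; ring.
  rewrite (le_trans (ler_normD _ _))// [leRHS]mulrDr lerD//.
    rewrite /k normrM (ger0_norm (expR_ge0 _)) ler_pM ?expR_ge0//.
    by rewrite ler_expR ler_pM2l// ltW.
  rewrite normrM (ger0_norm (x := t - s)); last by lra.
  rewrite /dk normrM (ger0_norm (expR_ge0 _)) -[leRHS]mulr1.
  rewrite ler_pM ?mulr_ge0 ?expR_ge0//; [by lra| |by lra].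
  rewrite ler_pM ?expR_ge0 ?yC//; last exact: lt_trans tT.
  by rewrite ler_expR ler_pM2l// ltW.
by move: kt; rewrite /k normrM (ger0_norm (expR_ge0 _)) ler_pM2l ?expR_gt0.
Qed.

Lemma expRM_small (R : realType) (k e : R) : 0 < k -> 0 < e ->
  \forall t \near -oo, expR (k * t) < e.
Proof.
move=> k0 e0; near=> t.
rewrite -[ltRHS]lnK ?posrE// ltr_expR mulrC -ltr_pdivlMr//.
by near: t; apply: nbhs_ninfty_lt; exact: num_real.
Unshelve. all: by end_near. Qed.

Lemma near_ninftyP (R : realType) (P : R -> Prop) :
  (\forall t \near -oo, P t) <-> exists T, forall t, t < T -> P t.
Proof.
split=> [[T [_ TP]]|[T TP]]; exists T => //.
by split; [exact: num_real|].
Qed.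

(** The energy [E = y'^2 + (y' + a y)^2 + 2 q y^2] is chosen so that the mixed
    terms cancel: if [y'' + a y' + q y = f] then
    [E' = - 2 a y'^2 - 2 a q y^2 + f (4 y' + 2 a y)].  By Young's inequality,
    and if [eta] is small, [E' <= - kappa E + D e^(2 sigma t)].  Multiplying by
    [e^(kappa t)] and integrating from [-oo], where [e^(kappa t) E] tends to 0
    because [E] is bounded, gives [E <= C e^(2 sigma t)]. *)
Lemma energy_decay (R : realType) (a q : R) : 0 < a -> 0 < q ->
  exists2 eta : R, 0 < eta &
    forall (T M B sigma : R) (y y1 y2 : R -> R),
    0 <= sigma ->
    (forall t, t < T -> is_derive t (1 : R) y (y1 t)) ->
    (forall t, t < T -> is_derive t (1 : R) y1 (y2 t)) ->
    (forall t, t < T -> `|y t| <= M) ->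
    (forall t, t < T ->
      `|y2 t + a * y1 t + q * y t| <= eta * `|y t| + B * expR (sigma * t)) ->
    exists C, forall t, t < T -> `|y t| <= C * expR (sigma * t).
Proof.
move=> a0 q0.
pose K := 4 / a + a / q.
have K0 : 0 < K by rewrite addr_gt0 ?divr_gt0.
(* [K] is the constant of Young's inequality below; with this [eta] the part of
   [K f^2] that comes from [eta |y|] is at most half of the damping [a q y^2]. *)
pose eta := Num.sqrt (a * q / (4 * K)).
have eta0 : 0 < eta by rewrite sqrtr_gt0 divr_gt0 ?mulr_gt0.
have etaE : 4 * K * eta ^+ 2 = a * q.
  by rewrite sqr_sqrtr ?divr_ge0 ?mulr_ge0 ?ltW//; field; rewrite gt_eqF.
exists eta => // T M B sigma y y1 y2 sigma0 Dy Dy1 yM yF.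
pose f t := y2 t + a * y1 t + q * y t.
have [M1 y1M] : exists M1, forall t, t < T -> `|y1 t| <= M1.
  exists (2 * M + (eta * M + `|B| * expR (sigma * T) + q * M)).
  apply: (@bounded_derivative R T a M _ y y1 y2) => // t tT.
  have -> : y2 t + a * y1 t = f t - q * y t by rewrite /f; ring.
  rewrite (le_trans (ler_normB _ _))// lerD//.
    rewrite (le_trans (yF _ tT))// lerD//; first by rewrite ler_pM2l ?yM.
    rewrite (le_trans (ler_norm _))// normrM (ger0_norm (expR_ge0 _)).
    by rewrite ler_wpM2l// ler_expR ler_wpM2l// ltW.
  by rewrite normrM (gtr0_norm q0) ler_pM2l ?yM.
pose E t := y1 t ^+ 2 + (y1 t + a * y t) ^+ 2 + 2 * q * y t ^+ 2.
pose dE t := - (2 * a * y1 t ^+ 2) - 2 * a * q * y t ^+ 2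
             + f t * (4 * y1 t + 2 * a * y t).
have DE t : t < T -> is_derive t (1 : R) E (dE t).
  move=> tT; have Dt := Dy _ tT; have Dt1 := Dy1 _ tT.
  apply: is_derive_eq.
  by rewrite /dE /f /GRing.scale /=; ring.
have fsq t : t < T -> f t ^+ 2 <= 2 * eta ^+ 2 * y t ^+ 2
                                 + 2 * B ^+ 2 * expR (2 * sigma * t).
  move=> tT; have -> : 2 * sigma * t = sigma * t + sigma * t by ring.
  rewrite expRD -(real_normK (num_real (f t))).
  have := yF _ tT; rewrite -/(f t) => le1.
  have le2 := lerXn2r 2 (normr_ge0 _) (le_trans (normr_ge0 _) le1) le1.
  apply: le_trans le2 _; rewrite -(real_normK (num_real (y t))).
  have := sqr_ge0 (eta * `|y t| - B * expR (sigma * t)); lra.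
(* [kappa] has to satisfy [kappa E <= a y'^2 + (a q / 2) y^2], where
   [E <= 3 y'^2 + (2 a^2 + 2 q) y^2]. *)
pose kappa := Num.min (a / 3) (a * q / (2 * (2 * a ^+ 2 + 2 * q))).
have D0 : 0 < 2 * a ^+ 2 + 2 * q by rewrite addr_gt0 ?mulr_gt0 ?exprn_gt0.
have kappa0 : 0 < kappa by rewrite lt_min !divr_gt0 ?mulr_gt0.
have k1 : 3 * kappa <= a.
  by rewrite mulrC -ler_pdivlMr// /kappa ge_min lexx.
have k2 : kappa * (2 * a ^+ 2 + 2 * q) <= a * q / 2.
  rewrite -ler_pdivlMr//; apply: (le_trans (y := a * q / (2 * (2 * a ^+ 2 + 2 * q)))).
    by rewrite /kappa ge_min lexx orbT.
  by rewrite invfM mulrA.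
pose D := 2 * K * B ^+ 2.
have Ddecay t : t < T -> dE t <= - (kappa * E t) + D * expR (2 * sigma * t).
  move=> tT; have := fsq _ tT; set f2 := f t; set e := expR _.
  set Y := y t; set Z := y1 t => Hf.
  have young : f2 * (4 * Z + 2 * a * Y)
               <= a * Z ^+ 2 + a * q * Y ^+ 2 + K * f2 ^+ 2.
    have e1 : 4 * f2 * Z <= a * Z ^+ 2 + 4 / a * f2 ^+ 2.
      have := sqr_ge0 (a * Z - 2 * f2) => h; rewrite -subr_ge0.
      have -> : a * Z ^+ 2 + 4 / a * f2 ^+ 2 - 4 * f2 * Z
                = (a * Z - 2 * f2) ^+ 2 / a by field; rewrite gt_eqF.
      by rewrite divr_ge0// ltW.
    have e2 : 2 * a * f2 * Y <= a * q * Y ^+ 2 + a / q * f2 ^+ 2.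
      rewrite -subr_ge0.
      have -> : a * q * Y ^+ 2 + a / q * f2 ^+ 2 - 2 * a * f2 * Y
                = a * (q * Y - f2) ^+ 2 / q by field; rewrite gt_eqF.
      by apply: divr_ge0; [apply: mulr_ge0; [exact: ltW|exact: sqr_ge0]|exact: ltW].
    by rewrite /K; lra.
  have Kf : K * f2 ^+ 2 <= a * q / 2 * Y ^+ 2 + D * e.
    have -> : a * q / 2 * Y ^+ 2 + D * e
              = K * (2 * eta ^+ 2 * Y ^+ 2 + 2 * B ^+ 2 * e).
      by rewrite -etaE /D; field.
    by rewrite ler_pM2l.
  have EQ : E t <= 3 * Z ^+ 2 + (2 * a ^+ 2 + 2 * q) * Y ^+ 2.
    by rewrite /E -/Y -/Z; have := sqr_ge0 (Z - a * Y); lra.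
  have kE : kappa * E t <= a * Z ^+ 2 + a * q / 2 * Y ^+ 2.
    apply: (@le_trans _ _ (kappa * (3 * Z ^+ 2 + (2 * a ^+ 2 + 2 * q) * Y ^+ 2))).
      by rewrite ler_pM2l.
    rewrite mulrDr lerD//.
      by rewrite mulrA [kappa * 3]mulrC ler_wpM2r ?sqr_ge0.
    by rewrite mulrA ler_wpM2r ?sqr_ge0.
  by rewrite /dE -/f2 -/Y -/Z; lra.
have D_ge0 : 0 <= D by rewrite /D mulr_ge0 ?sqr_ge0// ltW// mulr_gt0.
pose L := kappa + 2 * sigma.
have L0 : 0 < L by rewrite ltr_wpDr// mulr_ge0.
pose Phi t := expR (kappa * t) * E t - D / L * expR (L * t).
pose dPhi t := expR (kappa * t) * (kappa * E t + dE t) - D * expR (L * t).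
have DPhi t : t < T -> is_derive t (1 : R) Phi (dPhi t).
  move=> tT; have Dt := DE _ tT.
  have De1 := is_derive_expRM kappa t.
  have De2 := is_derive_expRM L t.
  apply: is_derive_eq.
  by rewrite /dPhi /GRing.scale /=; field; rewrite gt_eqF.
have Phi_le0 t : t < T -> Phi t <= 0.
  move=> tT; rewrite leNgt; apply/negP => Pt.
  pose Em := M1 ^+ 2 + (M1 + a * M) ^+ 2 + 2 * q * M ^+ 2 + 1.
  have Em0 : 0 < Em.
    by rewrite ltr_wpDl// !addr_ge0 ?sqr_ge0// mulr_ge0 ?sqr_ge0// ltW ?mulr_gt0.
  have EEm s : s < T -> E s <= Em.
    move=> sT; rewrite ler_wpDr//.
    have sqle (x m : R) : `|x| <= m -> x ^+ 2 <= m ^+ 2.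
      move=> xm; rewrite -(real_normK (num_real x)).
      by rewrite lerXn2r// nnegrE ?(le_trans _ xm).
    have yMs := yM _ sT; have y1Ms := y1M _ sT.
    rewrite !lerD ?sqle//.
      rewrite (le_trans (ler_normD _ _))// lerD//.
      by rewrite normrM (gtr0_norm a0) ler_pM2l.
    by rewrite ler_pM2l ?mulr_gt0// sqle.
  have /near_ninftyP[S SE] := expRM_small kappa0 (divr_gt0 Pt Em0).
  pose s := Num.min S t - 1.
  have sS : s < S by rewrite /s ltrBlDr gt_min ltrDl ltr01.
  have st : s < t by rewrite /s ltrBlDr gt_min [t < _]ltrDl ltr01 orbT.
  have sT := lt_trans st tT.
  have [c /andP[sc ct] PE] := mvt_below DPhi st tT.
  have cT := lt_trans ct tT.
  have dP0 : dPhi c <= 0.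
    rewrite /dPhi.
    have -> : L * c = kappa * c + 2 * sigma * c by rewrite /L; ring.
    rewrite expRD.
    have -> : forall A B' C w : R, A * B' - w * (A * C) = A * (B' - w * C).
      by move=> *; ring.
    rewrite mulr_ge0_le0 ?expR_ge0//.
    by have := Ddecay _ cT; lra.
  have : Phi t <= Phi s.
    rewrite -subr_le0 PE mulr_le0_ge0//; lra.
  apply/negP; rewrite -ltNge.
  have := SE _ sS; rewrite ltr_pdivlMr// => lt1.
  apply: le_lt_trans lt1; rewrite /Phi lerBlDr ler_wpDr//.
    by rewrite mulr_ge0 ?expR_ge0// divr_ge0// ltW.
  by rewrite ler_pM2l ?expR_gt0// EEm.
exists (Num.sqrt (D / L / (2 * q))) => t tT.
have qy : 2 * q * y t ^+ 2 <= D / L * expR (2 * sigma * t).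
  have := Phi_le0 _ tT; rewrite /Phi subr_le0.
  have -> : L * t = kappa * t + 2 * sigma * t by rewrite /L; ring.
  rewrite expRD mulrCA ler_pM2l ?expR_gt0//; apply: le_trans.
  by rewrite /E; have := sqr_ge0 (y1 t); have := sqr_ge0 (y1 t + a * y t); lra.
have D0' : 0 <= D / L / (2 * q).
  by rewrite divr_ge0 ?divr_ge0 ?(ltW L0)// ltW// mulr_gt0.
rewrite -(@ler_pXn2r _ 2)// ?nnegrE ?mulr_ge0 ?sqrtr_ge0 ?expR_ge0//.
rewrite real_normK ?num_real// exprMn sqr_sqrtr// -expRM_natl.
rewrite mulrA mulrAC ler_pdivlMr ?mulr_gt0// mulrC; exact: qy.
Qed.

(** The function [G = y' + a y] grows at least linearly in [t], whereas the mean
    value theorem provides, in every interval of length 1, a point where [G] is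
    at most [(2 + a) M] in absolute value. *)
Lemma no_bounded_solution (R : realType) (T a M kap : R) (y y1 y2 : R -> R) :
  0 < a -> 0 < kap ->
  (forall t, t < T -> is_derive t (1 : R) y (y1 t)) ->
  (forall t, t < T -> is_derive t (1 : R) y1 (y2 t)) ->
  (forall t, t < T -> `|y t| <= M) ->
  (forall t, t < T -> kap <= y2 t + a * y1 t) -> False.
Proof.
move=> a0 kap0 Dy Dy1 yM yk.
pose G t := y1 t + a * y t.
have DG t : t < T -> is_derive t (1 : R) G (y2 t + a * y1 t).
  move=> tT; have Dt := Dy _ tT; have Dt1 := Dy1 _ tT.
  by apply: is_derive_eq; rewrite /GRing.scale /=; ring.
have Gs t : t < T -> exists2 s, t - 1 < s < t & `|G s| <= (2 + a) * M.
  move=> tT; have t1 : t - 1 < t by lra.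
  have [s /andP[s1 st] ys] := mvt_below Dy t1 tT.
  exists s; first by rewrite s1 st.
  have y1s : `|y1 s| <= 2 * M.
    have -> : y1 s = y t - y (t - 1) by rewrite ys; ring.
    have := yM _ tT; have := yM _ (lt_trans t1 tT).
    by have := ler_normB (y t) (y (t - 1)); lra.
  rewrite (le_trans (ler_normD _ _))// mulrDl lerD//.
  by rewrite normrM (gtr0_norm a0) ler_pM2l// yM// (lt_trans st).
have M0 : 0 <= M by rewrite (le_trans _ (yM (T - 1) _))//; lra.
(* Over a distance [n], [G] increases by more than [2 (2 + a) M]. *)
pose n := 2 * (2 + a) * M / kap + 1.
have n0 : 0 < n by rewrite ltr_wpDl// !(mulr_ge0, invr_ge0)//; lra.
have [|s0 /andP[s01 s0T] Gs0] := Gs (T - 1); first lra.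
have [|s /andP[s1 sT] Gss] := Gs (T - 2 - n); first lra.
have ss0 : s < s0 by lra.
have s0T' : s0 < T by lra.
have [c /andP[sc cs0] GE] := mvt_below DG ss0 s0T'.
have : kap * n <= G s0 - G s.
  by rewrite GE ler_pM ?yk ?ltW//; lra.
have -> : kap * n = 2 * (2 + a) * M + kap.
  by rewrite /n; field; rewrite gt_eqF.
by have := ler_norm (G s0); have := lerNnormlW (lexx `|G s|); lra.
Qed.

(** * Taylor polynomials of real powers *)

(** The recursion changes [q] together with [j], so that differentiating the
    binomial series of exponent [q] visibly gives [q] times that of exponent
    [q - 1]. *)
Fixpoint gbinomial (R : realType) (q : R) (j : nat) : R :=
  if j is k.+1 then q * gbinomial (q - 1) k / k.+1%:R else 1.

Definition binomial_poly (R : realType) (q : R) (n : nat) : {poly R} :=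
  \poly_(j < n) gbinomial q j.

Lemma deriv_binomial_poly (R : realType) (q : R) (n : nat) :
  (binomial_poly q n.+1)^`() = q *: binomial_poly (q - 1) n.
Proof.
apply/polyP => i; rewrite coef_deriv coefZ !coef_poly ltnS.
case: ltnP => _; last by rewrite mul0rn mulr0.
by rewrite /= -[LHS]mulr_natr divfK// pnatr_eq0.
Qed.

Lemma is_derive_horner (R : realType) (p : {poly R}) (x : R) :
  is_derive x (1 : R) (horner p) (p^`()).[x].
Proof.
have /derivableP := @derivable_horner R p x.
by rewrite -derive1E -derivE.
Qed.

Lemma mvt_origin (R : realType) (r : R) (f df : R -> R) (y : R) :
  (forall x, `|x| < r -> is_derive x (1 : R) f (df x)) -> `|y| < r ->
  exists2 c, `|c| <= `|y| & f y - f 0 = df c * y.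
Proof.
move=> Df yr.
have [y0|y0|->] := ltgtP y 0; last first.
- by exists 0 => //; rewrite subrr mulr0.
- have [||c] := @MVT R f df 0 y y0.
  + move=> x; rewrite in_itv /= => /andP[x0 xy]; apply: Df.
    by rewrite gtr0_norm// (lt_trans xy)// -(gtr0_norm y0).
  + apply: derivable_within_continuous => x; rewrite in_itv /= => /andP[x0 xy].
    have xr : `|x| < r by rewrite ger0_norm// (le_lt_trans xy)// -(gtr0_norm y0).
    by have [] := Df x xr.
  + rewrite in_itv /= => /andP[c0 cy]; rewrite subr0 => E; exists c => //.
    by rewrite !gtr0_norm// ltW.
- have [||c] := @MVT R f df y 0 y0.
  + move=> x; rewrite in_itv /= => /andP[yx x0]; apply: Df.
    by rewrite ltr0_norm// (le_lt_trans _ yr)// (ltr0_norm y0) lerN2 ltW.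
  + apply: derivable_within_continuous => x; rewrite in_itv /= => /andP[yx x0].
    have xr : `|x| < r.
      by rewrite ler0_norm// (le_lt_trans _ yr)// (ltr0_norm y0) lerN2.
    by have [] := Df x xr.
  + rewrite in_itv /= => /andP[yc c0] E; exists c => //.
      by rewrite !ltr0_norm// lerN2 ltW.
    by rewrite -opprB E; ring.
Qed.

Lemma is_derive_powR1D (R : realType) (q x : R) : `|x| < 1 ->
  is_derive x (1 : R) (fun x => (1 + x) `^ q) (q * (1 + x) `^ (q - 1)).
Proof.
move=> /ltr_normlP[x1 _].
have x0 : 0 < 1 + x by lra.
have D1 := is_derive1_powR q x0.
have D2 : is_derive x (1 : R) (fun x => 1 + x) (1 : R).
  by apply: is_derive_eq; rewrite add0r mulr1.
have := @is_derive1_comp R (fun y => y `^ q) (fun x => 1 + x) x _ _ D1 D2.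
by rewrite mulr1.
Qed.

Lemma powR1D_bounded (R : realType) (q x : R) : `|x| <= 1 / 2 ->
  `|(1 + x) `^ q| <= expR `|q|.
Proof.
move=> /ler_normlP[x1 x2].
have x0 : 0 < 1 + x by lra.
rewrite (ger0_norm (powR_ge0 _ _)) /powR gt_eqF// ler_expR.
rewrite (le_trans (ler_norm _))// normrM -[leRHS]mulr1 ler_wpM2l//.
rewrite ler_norml; apply/andP; split; last first.
  by rewrite (le_trans (le_ln1Dx _))//; lra.
rewrite lerNl -lnV ?posrE//.
have -> : (1 + x)^-1 = 1 + ((1 + x)^-1 - 1) by ring.
have h2 : (1 + x)^-1 <= 2 by rewrite invf_ple ?posrE//; lra.
have h0 : 0 < (1 + x)^-1 by rewrite invr_gt0.
by rewrite (le_trans (le_ln1Dx _))//; lra.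
Qed.

(** Induction on the order for all exponents at once: the derivative of the
    error for [(n + 1, q)] is [q] times the error for [(n, q - 1)], and the error
    vanishes at 0. *)
Lemma powR1D_taylor (R : realType) (n : nat) (q : R) : exists2 C : R, 0 <= C &
  forall x, `|x| <= 1 / 2 ->
    `|(1 + x) `^ q - (binomial_poly q n).[x]| <= C * `|x| ^+ n.
Proof.
elim: n q => [|n IHn] q.
  exists (expR `|q|); first exact: expR_ge0.
  move=> x x2; rewrite expr0 mulr1.
  rewrite /binomial_poly (_ : \poly_(j < 0) _ = 0) ?horner0 ?subr0.
    exact: powR1D_bounded.
  by apply/polyP => i; rewrite coef_poly coef0.
have [C C0 IH] := IHn (q - 1).
exists (`|q| * C); first by rewrite mulr_ge0.
move=> x x2.
pose f x := (1 + x) `^ q - (binomial_poly q n.+1).[x].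
pose df x := q * ((1 + x) `^ (q - 1) - (binomial_poly (q - 1) n).[x]).
have Df y : `|y| < 1 -> is_derive y (1 : R) f (df y).
  move=> y1; have D1 := is_derive_powR1D q y1.
  have D2 := is_derive_horner (binomial_poly q n.+1) y.
  rewrite deriv_binomial_poly hornerZ in D2.
  by apply: is_derive_eq; rewrite /df; ring.
have x1 : `|x| < 1 by lra.
have [c cx] := mvt_origin Df x1.
have -> : f 0 = 0.
  rewrite /f addr0 powR1 horner_coef0 coef_poly /=; ring.
rewrite subr0 /f => ->.
rewrite !normrM -!mulrA ler_wpM2l// exprSr mulrA ler_wpM2r//.
rewrite (le_trans (IH c _))//; first exact: le_trans x2.
by rewrite ler_wpM2l// lerXn2r ?nnegrE.
Qed.

(** For a differentiable function this amounts to [gam'(x) = O(|x|)], so the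
    nonlinearity has no linear part at 0.  The radius [1 / 2] only keeps [1 + x]
    away from 0 for the function [powR_remainder] below. *)
Definition quadratically_small (R : realType) (gam : R -> R) :=
  exists2 C : R, 0 <= C & forall x y, `|x| <= 1 / 2 -> `|y| <= 1 / 2 ->
    `|gam x - gam y| <= C * (`|x| + `|y|) * `|x - y|.

Definition has_taylor_polynomials (R : realType) (gam : R -> R) :=
  forall n, exists (T : {poly R}) (C : R), forall x, `|x| <= 1 / 2 ->
    `|gam x - T.[x]| <= C * `|x| ^+ n.

(** The nonlinear part of [(1 + x)^(-p)] at 0. *)
Definition powR_remainder (R : realType) (p x : R) : R :=
  (1 + x) `^ (- p) - 1 + p * x.

Lemma powR_remainder0 (R : realType) (p : R) : powR_remainder p 0 = 0.
Proof. by rewrite /powR_remainder addr0 powR1; ring. Qed.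

Lemma powR_remainder_taylor (R : realType) (p : R) :
  has_taylor_polynomials (powR_remainder p).
Proof.
move=> n; have [C _ HC] := powR1D_taylor n (- p).
exists (binomial_poly (- p) n - 1 + p *: 'X), C => x x2.
rewrite /powR_remainder !hornerE.
rewrite (_ : _ - _ = (1 + x) `^ (- p) - (binomial_poly (- p) n).[x]).
  exact: HC.
by ring.
Qed.

Lemma powR_remainder_quadratic (R : realType) (p : R) :
  quadratically_small (powR_remainder p).
Proof.
have [C C0 HC] := powR1D_taylor 1 (- p - 1).
exists (`|p| * C); first by rewrite mulr_ge0.
pose dg (x : R) := - p * ((1 + x) `^ (- p - 1) - 1).
have Dg x : `|x| < 1 -> is_derive x (1 : R) (powR_remainder p) (dg x).
  move=> x1; have D1 := is_derive_powR1D (- p) x1.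
  by apply: is_derive_eq; rewrite /dg /GRing.scale /=; ring.
suff H x y : x < y -> `|x| <= 1 / 2 -> `|y| <= 1 / 2 ->
    `|powR_remainder p y - powR_remainder p x|
      <= `|p| * C * (`|y| + `|x|) * `|y - x|.
  move=> x y x2 y2; have [xy|yx|->] := ltgtP x y.
  - rewrite (distrC (powR_remainder p x)) (distrC x) (addrC `|x|).
    exact: H.
  - exact: H.
  - by rewrite !subrr normr0 mulr0.
move=> xy x2 y2.
have lt1 z : x <= z <= y -> `|z| < 1 /\ `|z| <= 1 / 2.
  move=> /andP[xz zy]; suff : `|z| <= 1 / 2 by move=> h; split=> //; lra.
  move: x2 y2 => /ler_normlP[? ?] /ler_normlP[? ?].
  by rewrite ler_norml; lra.
have [||c] := @MVT R (powR_remainder p) dg x y xy.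
- move=> z; rewrite in_itv /= => /andP[xz zy]; apply: Dg.
  by apply lt1; rewrite !ltW.
- apply: derivable_within_continuous => z; rewrite in_itv /= => xzy.
  by have [] := Dg z (lt1 z xzy).1.
rewrite in_itv /= => /andP[xc cy] ->.
have [c1 c2] : `|c| < 1 /\ `|c| <= 1 / 2 by apply: lt1; rewrite !ltW.
rewrite normrM ler_wpM2r// /dg normrM normrN -mulrA ler_wpM2l//.
have := HC c c2; rewrite /binomial_poly.
rewrite (_ : \poly_(j < 1) _ = 1) ?hornerC; last first.
  by apply/polyP => i; rewrite coef_poly coef1; case: i => [|i] //=.
move=> /le_trans; apply; rewrite expr1 ler_wpM2l//.
rewrite ler_norml; have := ler_norm y; have := lerNnormlW (lexx `|x|).
by have := normr_ge0 x; have := normr_ge0 y; lra.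
Qed.

(** * Orders of vanishing at the right of 0 *)

Definition vanishes (R : realType) (k : nat) (f : R -> R) :=
  exists C : R, \forall x \near 0^'+, `|f x| <= C * x ^+ k.

Lemma vanishesP (R : realType) (k : nat) (f : R -> R) : vanishes k f ->
  exists2 C : R, 0 <= C & \forall x \near 0^'+, `|f x| <= C * x ^+ k.
Proof.
move=> [C HC]; exists `|C| => //; near=> x.
have x0 : 0 < x by near: x; exact: nbhs_right_gt.
have H : `|f x| <= C * x ^+ k by near: x.
by rewrite (le_trans H)// ler_wpM2r ?exprn_ge0 ?ler_norm// ltW.
Unshelve. all: by end_near. Qed.

Lemma vanishes_eq (R : realType) (k : nat) (f g : R -> R) :
  (forall x, f x = g x) -> vanishes k f -> vanishes k g.
Proof. by move=> /funext ->. Qed.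

Lemma vanishesD (R : realType) (k : nat) (f g : R -> R) :
  vanishes k f -> vanishes k g -> vanishes k (fun x => f x + g x).
Proof.
move=> [C HC] [D HD]; exists (C + D); near=> x.
rewrite (le_trans (ler_normD _ _))// mulrDl lerD//; first by near: x.
by near: x.
Unshelve. all: by end_near. Qed.

Lemma vanishesM (R : realType) (i j : nat) (f g : R -> R) :
  vanishes i f -> vanishes j g -> vanishes (i + j) (fun x => f x * g x).
Proof.
move=> [C HC] [D HD]; exists (C * D); near=> x.
rewrite normrM exprD mulrACA ler_pM//; first by near: x.
by near: x.
Unshelve. all: by end_near. Qed.

Lemma vanishes_le (R : realType) (i j : nat) (f : R -> R) : (i <= j)%N ->
  vanishes j f -> vanishes i f.
Proof.
move=> ij /vanishesP[C C0 HC]; exists C; near=> x.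
have x0 : 0 < x by near: x; exact: nbhs_right_gt.
have x1 : x < 1 by near: x; exact: nbhs_right_lt.
have H : `|f x| <= C * x ^+ j by near: x.
by rewrite (le_trans H)// ler_wpM2l// ler_wiXn2l// ltW.
Unshelve. all: by end_near. Qed.

Lemma vanishes_cst (R : realType) (c : R) : vanishes 0 (fun=> c).
Proof. by exists `|c|; near=> x; rewrite expr0 mulr1.
Unshelve. all: by end_near. Qed.

Lemma vanishesX (R : realType) (k : nat) : vanishes k (fun x : R => x ^+ k).
Proof.
exists 1; near=> x; have x0 : 0 < x by near: x; exact: nbhs_right_gt.
by rewrite mul1r ger0_norm// exprn_ge0// ltW.
Unshelve. all: by end_near. Qed.

Lemma vanishes_cM (R : realType) (k : nat) (c : R) (f : R -> R) :
  vanishes k f -> vanishes k (fun x => c * f x).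
Proof. by move=> vf; exact: (vanishesM (vanishes_cst c) vf). Qed.

Lemma vanishes_horner (R : realType) (p : {poly R}) : vanishes 0 (horner p).
Proof.
elim/poly_ind: p => [|p c IH].
  by apply: (vanishes_eq _ (vanishes_cst 0)) => x; rewrite horner0.
have H := vanishesM IH (vanishesX R 1).
apply: (@vanishes_eq _ _ (fun x => p.[x] * x ^+ 1 + c)).
  by move=> x; rewrite !hornerE.
apply: vanishesD; last exact: vanishes_cst.
exact: vanishes_le H.
Qed.

Lemma vanishes_root0 (R : realType) (p : {poly R}) : p.[0] = 0 ->
  vanishes 1 (horner p).
Proof.
move=> /rootP/factor_theorem[s ->].
apply: (@vanishes_eq _ _ (fun x => s.[x] * x ^+ 1)).
  by move=> x; rewrite !hornerE subr0.
exact: (vanishesM (vanishes_horner s) (vanishesX R 1)).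
Qed.

Lemma vanishes_cst_eq0 (R : realType) (c : R) : vanishes 1 (fun=> c) -> c = 0.
Proof.
move=> /vanishesP[C C0 HC]; apply/eqP; rewrite -normr_eq0 eq_le normr_ge0 andbT.
rewrite leNgt; apply/negP => c0.
have d0 : 0 < `|c| / (C + 1) by rewrite divr_gt0// ltr_wpDl.
have : \forall x \near (0 : R)^'+, False.
  near=> x.
  have x0 : 0 < x by near: x; exact: nbhs_right_gt.
  have xd : x < `|c| / (C + 1) by near: x; exact: nbhs_right_lt.
  have H : `|c| <= C * x ^+ 1 by near: x.
  by move: xd; rewrite ltr_pdivlMr ?ltr_wpDl//; lra.
by move=> /filter_ex[].
Unshelve. all: by end_near. Qed.

(** A polynomial that is [O(x^k)] near [0] is a multiple of [x^k], and [d] is its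
    coefficient of degree [k]; dividing by ['X] lowers [k]. *)
Lemma vanishes_horner_lead (R : realType) (k : nat) (p : {poly R}) :
  vanishes k (horner p) ->
  exists d, vanishes k.+1 (fun x => p.[x] - d * x ^+ k).
Proof.
elim: k p => [|k IH] p vp.
  exists p.[0]; apply: (@vanishes_eq _ _ (horner (p - p.[0]%:P))).
    by move=> x; rewrite !hornerE.
  by apply: vanishes_root0; rewrite !hornerE subrr.
have p0 : p.[0] = 0.
  apply: vanishes_cst_eq0.
  have H : vanishes 1 (horner (p - p.[0]%:P)).
    by apply: vanishes_root0; rewrite !hornerE subrr.
  apply: (@vanishes_eq _ _ (fun x => p.[x] + -1 * (p - p.[0]%:P).[x])).
    by move=> x; rewrite !hornerE; ring.
  apply: vanishesD; last exact: vanishes_cM.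
  exact: vanishes_le vp.
have /rootP/factor_theorem[s ps] := p0.
have vs : vanishes k (horner s).
  have [C HC] := vp; exists C; near=> x.
  have x0 : 0 < x by near: x; exact: nbhs_right_gt.
  have H : `|p.[x]| <= C * x ^+ k.+1 by near: x.
  move: H; rewrite ps !hornerE subr0 normrM exprSr mulrA (gtr0_norm x0).
  by rewrite ler_pM2r.
have [d Hd] := IH _ vs; exists d.
apply: (@vanishes_eq _ _ (fun x => (s.[x] - d * x ^+ k) * x ^+ 1)).
  by move=> x; rewrite ps hornerM hornerXsubC subr0 [x ^+ k.+1]exprSr; ring.
by rewrite -addn1; apply: vanishesM => //; exact: vanishesX.
Unshelve. all: by end_near. Qed.

Lemma vanishes_small (R : realType) (f : R -> R) (e : R) : 0 < e ->
  vanishes 1 f -> \forall x \near 0^'+, `|f x| <= e.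
Proof.
move=> e0 /vanishesP[C C0 HC]; near=> x.
have x0 : 0 < x by near: x; exact: nbhs_right_gt.
have xd : x < e / (C + 1).
  by near: x; apply: nbhs_right_lt; rewrite divr_gt0// ltr_wpDl.
have H : `|f x| <= C * x ^+ 1 by near: x.
by move: xd; rewrite ltr_pdivlMr ?ltr_wpDl//; lra.
Unshelve. all: by end_near. Qed.

(** * The formal solution *)

(** In the variable [x = e^(rho t)], [d/dt] acts on polynomials in [x] as [rho]
    times the operator [euler]. *)
Definition euler (R : realType) (S : {poly R}) : {poly R} := 'X * S^`().

Definition poly_operator (R : realType) (rho a q : R) (S : {poly R}) :
  {poly R} := rho ^+ 2 *: euler (euler S) + (a * rho) *: euler S + q *: S.

Definition residual (R : realType) (rho a q b F : R) (gam : R -> R)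
    (S : {poly R}) (x : R) : R :=
  (poly_operator rho a q S).[x] - b * gam S.[x] - F * x.

Definition char_value (R : realType) (rho a q : R) (k : nat) : R :=
  (k%:R * rho) ^+ 2 + a * (k%:R * rho) + q.

Lemma poly_operatorD (R : realType) (rho a q : R) (S1 S2 : {poly R}) :
  poly_operator rho a q (S1 + S2)
  = poly_operator rho a q S1 + poly_operator rho a q S2.
Proof.
rewrite /poly_operator /euler !(derivD, mulrDr, scalerDr).
by ring.
Qed.

Lemma poly_operatorX (R : realType) (rho a q c : R) (k : nat) :
  poly_operator rho a q (c *: 'X^k) = (char_value rho a q k * c) *: 'X^k.
Proof.
have eX (d : R) : euler (d *: 'X^k) = (k%:R * d) *: 'X^k.
  rewrite /euler derivZ derivXn -scalerAr; case: k => [|k].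
    by rewrite mulr0n mulr0 scaler0 mul0r scale0r.
  by rewrite mulrnAr -exprS /= -scaler_nat scalerA mulrC.
by rewrite /poly_operator !eX !scalerA -!scalerDl /char_value; congr (_ *: _); ring.
Qed.

(** Replacing [gam] by a Taylor polynomial shows that the residual of [S] is
    [d x^(k+1) + O(x^(k+2))].  Adding [c x^(k+1)] to [S] changes its linear part
    by [char_value (k+1) c x^(k+1)], and the nonlinear part by [O(x^(k+2))] only,
    because [gam] is quadratically small; so [c] can cancel [d]. *)
Lemma next_coefficient (R : realType) (rho a q b F : R) (gam : R -> R)
    (S : {poly R}) (k : nat) :
  quadratically_small gam ->
  has_taylor_polynomials gam ->
  char_value rho a q k.+1 != 0 -> S.[0] = 0 ->
  vanishes k.+1 (residual rho a q b F gam S) ->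
  exists c, vanishes k.+2 (residual rho a q b F gam (S + c *: 'X^(k.+1))).
Proof.
move=> [L L0 lip] tay ch0 S0 vS.
have vS1 := vanishes_root0 S0.
have Ssmall := @vanishes_small R (horner S) (1 / 2) _ vS1.
have [T [C HC]] := tay k.+2.
pose A := poly_operator rho a q S - b *: (T \Po S) - F *: 'X.
pose err x := b * (T.[S.[x]] - gam S.[x]).
have resE x : residual rho a q b F gam S x = A.[x] + err x.
  rewrite /residual /A /err !(hornerE, horner_comp); ring.
have verr : vanishes k.+2 err.
  apply: vanishes_cM.
  have [C1 C10 HC1] := vanishesP vS1.
  exists (`|C| * C1 ^+ k.+2); near=> x.
  have S2 : `|S.[x]| <= 1 / 2 by near: x; apply: Ssmall; lra.
  have S3 : `|S.[x]| <= C1 * x ^+ 1 by near: x.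
  rewrite distrC (le_trans (HC _ S2))// -mulrA -exprMn.
  apply: (@le_trans _ _ (`|C| * `|S.[x]| ^+ k.+2)).
    by rewrite ler_wpM2r ?exprn_ge0 ?ler_norm.
  by rewrite ler_wpM2l// lerXn2r ?nnegrE// (le_trans _ S3).
have vA : vanishes k.+1 (horner A).
  apply: (@vanishes_eq _ _ (fun x => residual rho a q b F gam S x
                                     + -1 * err x)).
    by move=> x; rewrite resE; ring.
  by apply: vanishesD => //; apply/vanishes_cM/(@vanishes_le _ _ k.+2).
have [d Hd] := vanishes_horner_lead vA.
pose c := - d / char_value rho a q k.+1.
exists c; set S' := S + _.
have S'0 : S'.[0] = 0 by rewrite !hornerE S0 expr0n /= mulr0 addr0.
have vS'1 := vanishes_root0 S'0.
have S'small := @vanishes_small R (horner S') (1 / 2) _ vS'1.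
have vdiff : vanishes k.+2 (fun x => gam S'.[x] - gam S.[x]).
  have [C1 C10 HC1] := vanishesP vS1.
  have [C2 C20 HC2] := vanishesP vS'1.
  exists (L * (C2 + C1) * `|c|); near=> x.
  have x0 : 0 < x by near: x; exact: nbhs_right_gt.
  have H1 : `|S.[x]| <= 1 / 2 by near: x; apply: Ssmall; lra.
  have H2 : `|S'.[x]| <= 1 / 2 by near: x; apply: S'small; lra.
  have H3 : `|S.[x]| <= C1 * x ^+ 1 by near: x.
  have H4 : `|S'.[x]| <= C2 * x ^+ 1 by near: x.
  rewrite (le_trans (lip _ _ H2 H1))//.
  have -> : `|S'.[x] - S.[x]| = `|c| * x ^+ k.+1.
    rewrite /S' hornerD hornerZ hornerXn.
    rewrite (_ : S.[x] + _ - _ = c * x ^+ k.+1); last by ring.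
    by rewrite normrM (ger0_norm (exprn_ge0 _ (ltW x0))).
  have -> : L * (C2 + C1) * `|c| * x ^+ k.+2
            = L * ((C2 + C1) * x) * (`|c| * x ^+ k.+1) by rewrite exprS; ring.
  rewrite ler_wpM2r ?mulr_ge0 ?exprn_ge0 ?(ltW x0)// ler_wpM2l//.
  by rewrite mulrDl lerD.
apply: (@vanishes_eq _ _ (fun x => ((A.[x] - d * x ^+ k.+1) + err x)
                                  + (- b) * (gam S'.[x] - gam S.[x]))).
  move=> x; rewrite /residual poly_operatorD poly_operatorX hornerD hornerZ.
  rewrite hornerXn /c mulrCA mulfV// mulr1.
  have := resE x; rewrite /residual => h.
  have -> : A.[x] = (poly_operator rho a q S).[x] - b * gam S.[x] - F * x - err x.
    by rewrite h; ring.
  by ring.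
by apply: vanishesD; [exact: vanishesD|exact: vanishes_cM].
Unshelve. all: by end_near. Qed.

(** The coefficients do not depend on the truncation order [k]: they come from a
    single recursion. *)
Lemma formal_solution (R : realType) (rho a q b F : R) (gam : R -> R) :
  gam 0 = 0 ->
  quadratically_small gam ->
  has_taylor_polynomials gam ->
  (forall k, char_value rho a q k.+1 != 0) ->
  exists c : nat -> R, forall k, vanishes k.+1
    (residual rho a q b F gam (\sum_(1 <= l < k.+1) c l *: 'X^l)).
Proof.
move=> gam0 lip tay ch0.
have /choice[step stepP] : forall kS : nat * {poly R}, exists d : R,
    kS.2.[0] = 0 -> vanishes kS.1.+1 (residual rho a q b F gam kS.2) ->
    vanishes kS.1.+2
      (residual rho a q b F gam (kS.2 + d *: 'X^(kS.1.+1))).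
  (* The step is made total by a dummy coefficient 0, so that choice applies. *)
  move=> [k S] /=; have [[S0 vS]|nS] := pselect (S.[0] = 0 /\
      vanishes k.+1 (residual rho a q b F gam S)).
    by have [d Hd] := next_coefficient lip tay (ch0 k) S0 vS; exists d.
  by exists 0 => S0 vS; case: nS.
pose S k : {poly R} := iteri k (fun i P => P + step (i, P) *: 'X^(i.+1)) 0.
exists (fun l => step (l.-1, S l.-1)) => k.
have -> : \sum_(1 <= l < k.+1) step (l.-1, S l.-1) *: 'X^l = S k.
  elim: k => [|k IH]; first by rewrite big_geq.
  by rewrite big_nat_recr//= IH.
suff : (S k).[0] = 0 /\ vanishes k.+1 (residual rho a q b F gam (S k)).
  by case.
elim: k => [|k [S0 vS]]; last first.
  split; last exact: (stepP (k, S k)).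
  by rewrite /= !hornerE S0 expr0n /= mulr0 addr0.
split; first by rewrite /= horner0.
apply: (@vanishes_eq _ _ (fun x => (- F) * x ^+ 1)); last first.
  exact/vanishes_cM/vanishesX.
move=> x; rewrite /residual /poly_operator /euler /= derivC mulr0 derivC mulr0.
by rewrite !scaler0 !addr0 horner0 gam0; ring.
Qed.

(** * Comparison of solutions with the formal solution *)

Lemma near_expR (R : realType) (rho : R) (P : R -> Prop) : 0 < rho ->
  (\forall x \near 0^'+, P x) -> \forall t \near -oo, P (expR (rho * t)).
Proof.
move=> rho0 [e /= e0 He]; near=> t.
apply: He; last exact: expR_gt0.
rewrite /= sub0r normrN (ger0_norm (expR_ge0 _)).
by near: t; exact: expRM_small.
Unshelve. all: by end_near. Qed.

Lemma is_derive_horner_expR (R : realType) (rho : R) (S : {poly R}) (t : R) :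
  is_derive t (1 : R) (fun t => S.[expR (rho * t)])
    (rho * (euler S).[expR (rho * t)]).
Proof.
have D1 := is_derive_expRM rho t.
have D2 := is_derive_horner S (expR (rho * t)).
have := @is_derive1_comp R (horner S) (fun t => expR (rho * t)) t _ _ D2 D1.
by rewrite /euler hornerM hornerX; congr is_derive; ring.
Qed.

(** The difference [d] of [y] and the truncated formal solution satisfies
    [d'' + a d' + q d = b (gam(y) - gam(S)) - residual].  As [y] and [S] tend to
    0, the first term is at most [eta |d|] near [-oo], whatever [eta] is, and
    [energy_decay] applies with [sigma = (k + 1) rho]. *)
Lemma asymptotic_expansion (R : realType) (rho a q b F T : R) (gam : R -> R)
    (y y1 y2 : R -> R) :
  0 < rho -> 0 < a -> 0 < q -> gam 0 = 0 ->
  quadratically_small gam ->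
  has_taylor_polynomials gam ->
  (forall t, t < T -> is_derive t (1 : R) y (y1 t)) ->
  (forall t, t < T -> is_derive t (1 : R) y1 (y2 t)) ->
  (forall e, 0 < e -> \forall t \near -oo, `|y t| <= e) ->
  (forall t, t < T ->
    y2 t + a * y1 t + q * y t = b * gam (y t) + F * expR (rho * t)) ->
  exists c : nat -> R, forall k, exists C : R, \forall t \near -oo,
    `|y t - \sum_(1 <= l < k.+1) c l * expR (l%:R * rho * t)|
      <= C * expR (k.+1%:R * rho * t).
Proof.
move=> rho0 a0 q0 gam0 lip tay Dy Dy1 y0 ode.
have ch0 k : char_value rho a q k.+1 != 0.
  rewrite gt_eqF// /char_value.
  by rewrite ltr_wpDl// addr_ge0 ?sqr_ge0// !mulr_ge0// ltW.
have [c Hc] := formal_solution b F gam0 lip tay ch0.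
exists c => k; have vS := Hc k.
set S : {poly R} := \sum_(1 <= l < k.+1) c l *: 'X^l in vS.
have SE t : \sum_(1 <= l < k.+1) c l * expR (l%:R * rho * t)
            = S.[expR (rho * t)].
  rewrite /S horner_sum; apply: eq_bigr => l _.
  by rewrite hornerZ hornerXn -expRM_natl mulrA.
have S0 : S.[0] = 0.
  rewrite /S horner_sum big_nat big1// => l /andP[l1 _].
  by rewrite hornerZ hornerXn expr0n eqn0Ngt l1 mulr0.
have [L L0 HL] := lip.
have [eta eta0 decay] := energy_decay a0 q0.
pose e := Num.min (1 / 2) (eta / (2 * (`|b| * L + 1))).
have bL0 : 0 < 2 * (`|b| * L + 1).
  by rewrite mulr_gt0// ltr_wpDl// mulr_ge0.
have e0 : 0 < e by rewrite lt_min !divr_gt0//.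
have e12 : e <= 1 / 2 by rewrite /e ge_min lexx.
have eeta : `|b| * L * (e + e) <= eta.
  have : e <= eta / (2 * (`|b| * L + 1)) by rewrite /e ge_min lexx orbT.
  rewrite ler_pdivlMr// => h; have : 0 <= e by exact: ltW.
  by lra.
have /near_ninftyP[T1 HT1] := y0 _ e0.
have /near_ninftyP[T2 HT2] := near_expR rho0
  (vanishes_small e0 (vanishes_root0 S0)).
have [B B0 HB] := vanishesP vS.
have /near_ninftyP[T3 HT3] := near_expR rho0 HB.
pose T0 := Num.min (Num.min T T1) (Num.min T2 T3).
pose d t := y t - S.[expR (rho * t)].
pose d1 t := y1 t - rho * (euler S).[expR (rho * t)].
pose d2 t := y2 t - rho * (rho * (euler (euler S)).[expR (rho * t)]).
have [|||||C HC] := decay T0 (e + e) B (k.+1%:R * rho) d d1 d2.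
- by rewrite mulr_ge0// ltW.
- move=> t; rewrite !lt_min -!andbA => /and4P[tT tT1 tT2 tT3].
  have D1 := Dy _ tT; have D2 := is_derive_horner_expR rho S t.
  exact: is_deriveB.
- move=> t; rewrite !lt_min -!andbA => /and4P[tT tT1 tT2 tT3].
  have D1 := Dy1 _ tT.
  have D2 := is_derive_horner_expR rho (euler S) t.
  apply: is_derive_eq.
  by rewrite /d2 /GRing.scale /=; ring.
- move=> t; rewrite !lt_min -!andbA => /and4P[tT tT1 tT2 tT3].
  by rewrite (le_trans (ler_normB _ _))// lerD ?HT1 ?HT2.
- move=> t; rewrite !lt_min -!andbA => /and4P[tT tT1 tT2 tT3].
  have := HT1 _ tT1; have := HT2 _ tT2; have := HT3 _ tT3.
  have := ode _ tT; rewrite /d2 /d1 /d.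
  set X := expR (rho * t) => odet resX SX yX.
  have -> : y2 t - rho * (rho * (euler (euler S)).[X])
      + a * (y1 t - rho * (euler S).[X]) + q * (y t - S.[X])
      = b * (gam (y t) - gam S.[X]) - residual rho a q b F gam S X.
    rewrite /residual /poly_operator !(hornerD, hornerZ).
    have -> : y2 t = b * gam (y t) + F * X - a * y1 t - q * y t.
      by rewrite -odet; ring.
    by ring.
  rewrite (le_trans (ler_normB _ _))// lerD//; last first.
    by rewrite (le_trans resX)// -mulrA expRM_natl.
  rewrite normrM; apply: (@le_trans _ _
    (`|b| * (L * (`|y t| + `|S.[X]|) * `|y t - S.[X]|))).
    by rewrite ler_wpM2l// HL// (le_trans _ e12).
  rewrite !mulrA ler_wpM2r// (le_trans _ eeta)// ler_wpM2l ?mulr_ge0//.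
  exact: lerD.
exists C; apply/near_ninftyP; exists T0 => t tT0.
by rewrite SE; exact: HC.
Qed.

(** For [t < 0] the exponential is at least 1, so once
    [|b gam(y) - q y| <= |F| / 2] the function [y'' + a y'], multiplied by the
    sign of [F], is at least [|F| / 2]. *)
Lemma no_solution_nonpos_rho (R : realType) (rho a q b F T : R)
    (gam y y1 y2 : R -> R) :
  0 < a -> rho <= 0 -> F != 0 -> gam 0 = 0 ->
  quadratically_small gam ->
  (forall t, t < T -> is_derive t (1 : R) y (y1 t)) ->
  (forall t, t < T -> is_derive t (1 : R) y1 (y2 t)) ->
  (forall e, 0 < e -> \forall t \near -oo, `|y t| <= e) ->
  (forall t, t < T ->
    y2 t + a * y1 t + q * y t = b * gam (y t) + F * expR (rho * t)) ->
  False.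
Proof.
move=> a0 rho0 F0 gam0 [L L0 lip] Dy Dy1 y0 ode.
pose K := `|b| * L + `|q| + 1.
have K0 : 0 < K by rewrite ltr_wpDl// addr_ge0 ?mulr_ge0.
pose e := Num.min (1 / 2) (`|F| / (2 * K)).
have F_gt0 : 0 < `|F| by rewrite normr_gt0.
have e0 : 0 < e by rewrite lt_min !divr_gt0// mulr_gt0.
have e12 : e <= 1 / 2 by rewrite /e ge_min lexx.
have eF : e * K <= `|F| / 2.
  rewrite -ler_pdivlMr// -mulrA -invfM.
  by rewrite /e ge_min lexx orbT.
have /near_ninftyP[T1 HT1] := y0 _ e0.
pose T0 := Num.min (Num.min T T1) 0.
pose s := Num.sg F.
have s1 : `|s| = 1 by rewrite /s normr_sg F0.
apply: (@no_bounded_solution R T0 a e (`|F| / 2) (fun t => s * y t)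
  (fun t => s * y1 t) (fun t => s * y2 t)) => //.
- by rewrite divr_gt0.
- move=> t; rewrite !lt_min -!andbA => /and3P[tT tT1 t0].
  by have D1 := Dy _ tT; apply: is_derive_eq; rewrite /GRing.scale /=; ring.
- move=> t; rewrite !lt_min -!andbA => /and3P[tT tT1 t0].
  by have D1 := Dy1 _ tT; apply: is_derive_eq; rewrite /GRing.scale /=; ring.
- move=> t; rewrite !lt_min -!andbA => /and3P[tT tT1 t0].
  by rewrite normrM s1 mul1r HT1.
move=> t; rewrite !lt_min -!andbA => /and3P[tT tT1 t0].
have ye := HT1 _ tT1; have y12 := le_trans ye e12.
have -> : s * y2 t + a * (s * y1 t)
          = s * (b * gam (y t) - q * y t) + `|F| * expR (rho * t).
  have -> : y2 t = b * gam (y t) + F * expR (rho * t) - a * y1 t - q * y t.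
    by rewrite -ode//; ring.
  by rewrite [`|F|]normrEsg -/s; ring.
have X1 : 1 <= expR (rho * t).
  by rewrite -expR0 ler_expR mulr_le0// ltW.
have gy : `|gam (y t)| <= L * `|y t|.
  have := lip (y t) 0 y12; rewrite normr0 gam0 !subr0 addr0.
  move=> /(_ _)/le_trans; apply; first lra.
  rewrite -mulrA ler_wpM2l// -[leRHS]mulr1 ler_wpM2l//; lra.
have bnd : `|s * (b * gam (y t) - q * y t)| <= `|F| / 2.
  rewrite normrM s1 mul1r; apply: le_trans eF.
  rewrite (le_trans (ler_normB _ _))// !normrM.
  apply: (@le_trans _ _ ((`|b| * L + `|q|) * `|y t|)).
    by rewrite mulrDl lerD// -mulrA ler_wpM2l.
  rewrite [leRHS]mulrC ler_pM ?addr_ge0 ?mulr_ge0//.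
  by rewrite /K lerDl.
have := lerNnormlW bnd.
have : `|F| <= `|F| * expR (rho * t) by rewrite -[leLHS]mulr1 ler_wpM2l.
lra.
Qed.

(** * The radial equation *)

Lemma is_derive_line (R : realType) (V : normedModType R) (f : V -> R)
    (x w : V) (s : R) : derivable f (x + s *: w) w ->
  is_derive s (1 : R) (fun s => f (x + s *: w)) ('D_w f (x + s *: w)).
Proof.
move=> df.
have E : (fun h : R => h^-1 *: (((fun s => f (x + s *: w)) \o shift s) (h *: 1)
                                - f (x + s *: w)))
       = (fun h => h^-1 *: ((f \o shift (x + s *: w)) (h *: w) - f (x + s *: w))).
  apply/funext => h /=; congr (_ *: (f _ - _)).
  by rewrite [h *: 1]mulr1 scalerDl addrCA.
by split; rewrite /derivable /derive E.
Qed.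

Lemma enorm_axes (R : realType) (N : nat) (i j : 'I_N) (r s : R) : i != j ->
  enorm (r *: delta_mx 0 i + s *: delta_mx 0 j : 'rV[R]_N)
  = Num.sqrt (r ^+ 2 + s ^+ 2).
Proof.
move=> ij; rewrite /enorm (bigD1 i)//= (bigD1 j) ?[j == _]eq_sym//=.
rewrite big1 ?addr0 => [|k /andP[ki kj]].
  rewrite !mxE !eqxx (negbTE ij) [j == i]eq_sym (negbTE ij) /=.
  by rewrite !mulr1 !mulr0 addr0 add0r.
by rewrite !mxE (negbTE ki) (negbTE kj) !mulr0 addr0 expr0n.
Qed.

Lemma enorm_axis (R : realType) (N : nat) (i : 'I_N) (r : R) : 0 < r ->
  enorm (r *: delta_mx 0 i : 'rV[R]_N) = r.
Proof.
move=> r0; rewrite /enorm (bigD1 i)//= big1 ?addr0 => [|k ki].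
  by rewrite !mxE !eqxx mulr1 sqrtr_sqr gtr0_norm.
by rewrite !mxE (negbTE ki) mulr0 expr0n.
Qed.

Lemma axis_neq0 (R : realType) (N : nat) (i : 'I_N) (r : R) : 0 < r ->
  r *: delta_mx 0 i != 0 :> 'rV[R]_N.
Proof.
move=> r0; apply/eqP => /matrixP/(_ 0 i); rewrite !mxE !eqxx mulr1 => r00.
by move: r0; rewrite r00 ltxx.
Qed.

Lemma enorm0 (R : realType) (N : nat) : enorm (0 : 'rV[R]_N) = 0.
Proof.
by rewrite /enorm big1 ?sqrtr0// => i _; rewrite mxE expr0n.
Qed.

(** Along the line [r e_i + s e_j] the function is [v (sqrt (r^2 + s^2))], so
    its derivative in [s] is [v1 sg * (s / sg)] with [sg = sqrt (r^2 + s^2)].  At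
    [s = 0] only the derivative of the factor [s] contributes to the next
    derivative. *)
Lemma radial_transverse (R : realType) (N : nat) (u : 'rV[R]_N -> R)
    (v v1 v2 : R -> R) (i j : 'I_N) (r : R) :
  (forall x, u x = v (enorm x)) ->
  (forall x, x != 0 -> derivable u x (delta_mx 0 j)) ->
  (forall r : R, 0 < r -> is_derive r (1 : R) v (v1 r)) ->
  (forall r : R, 0 < r -> is_derive r (1 : R) v1 (v2 r)) ->
  i != j -> 0 < r -> derivable (partial j u) (r *: delta_mx 0 i) (delta_mx 0 j) ->
  partial j (partial j u) (r *: delta_mx 0 i) = v1 r / r.
Proof.
move=> uv du Dv Dv1 ij r0 ddu.
pose sg s := Num.sqrt (r ^+ 2 + s ^+ 2).
have sg_gt0 s : 0 < r ^+ 2 + s ^+ 2 by rewrite ltr_wpDr ?sqr_ge0 ?exprn_gt0.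
have sg0 s : 0 < sg s by rewrite sqrtr_gt0.
pose x s : 'rV[R]_N := r *: delta_mx 0 i + s *: delta_mx 0 j.
have Dsg s : is_derive s (1 : R) sg (s / sg s).
  have D1 : is_derive s (1 : R) (fun s : R => r ^+ 2 + s ^+ 2) (2 * s).
    by apply: is_derive_eq; rewrite /GRing.scale /=; ring.
  have D2 := is_derive1_sqrt (sg_gt0 s).
  have := @is_derive1_comp R Num.sqrt (fun s => r ^+ 2 + s ^+ 2) s _ _ D2 D1.
  rewrite (_ : _ * _ = s / sg s) // -/(sg s); field; exact: lt0r_neq0.
have x_neq0 s : x s != 0.
  apply/eqP => x0; have := enorm_axes r s ij.
  by rewrite -/(x s) x0 enorm0 => h; have := sg0 s; rewrite /sg -h ltxx.
have pE s : partial j u (x s) = v1 (sg s) * (s / sg s).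
  have D1 := @is_derive_line R _ u (r *: delta_mx 0 i) (delta_mx 0 j) s
    (du _ (x_neq0 s)).
  rewrite /partial -(derive_val (is_derive := D1)).
  have -> : (fun s => u (r *: delta_mx 0 i + s *: delta_mx 0 j)) = v \o sg.
    by apply/funext => s'; rewrite uv enorm_axes.
  have Ds := Dsg s; have Dvs := Dv _ (sg0 s).
  exact: (derive_val (is_derive := @is_derive1_comp R v sg s _ _ Dvs Ds)).
have x0E : x 0 = r *: delta_mx 0 i by rewrite /x scale0r addr0.
have D1 := @is_derive_line R _ (partial j u) (r *: delta_mx 0 i) (delta_mx 0 j) 0.
rewrite -/(x 0) x0E in D1; have {}D1 := D1 ddu.
rewrite {1}/partial -(derive_val (is_derive := D1)).
have -> : (fun s => partial j u (r *: delta_mx 0 i + s *: delta_mx 0 j))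
          = (fun s => v1 (sg s) * (s / sg s)).
  by apply/funext => s; exact: pE.
have sg00 : sg 0 = r by rewrite /sg expr0n addr0 sqrtr_sqr gtr0_norm.
have Ds := Dsg 0; rewrite sg00 mul0r in Ds.
have Dv1s : is_derive (0 : R) (1 : R) (fun s => v1 (sg s)) (v2 r * 0).
  apply: is_derive1_comp; rewrite sg00; exact: Dv1.
have Dq : is_derive (0 : R) (1 : R) (fun s => s / sg s) (r^-1).
  have DV : is_derive (0 : R) (1 : R) (fun s => (sg s)^-1) 0.
    have sn0 : sg 0 != 0 by rewrite sg00 gt_eqF.
    by have := is_deriveV sn0 Ds; rewrite scaler0.
  by apply: is_derive_eq; rewrite sg00 /GRing.scale /=; ring.
have DM := is_deriveM Dv1s Dq.
by rewrite (derive_val (is_derive := DM)) sg00 /GRing.scale /=; ring.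
Qed.

(** The equation is evaluated on the first coordinate axis: the second
    derivative along the axis is [v''], and each of the other [N - 1] second
    derivatives is [v' / r]. *)
Lemma radial_ode (R : realType) (N : nat) (lambda alpha p F : R)
    (u : 'rV[R]_N -> R) (v : R -> R) : (2 <= N)%N ->
  rupture_solution lambda alpha p F u ->
  (forall x, u x = v (enorm x)) ->
  exists v1 v2 : R -> R, forall r : R, 0 < r ->
    [/\ is_derive r (1 : R) v (v1 r), is_derive r (1 : R) v1 (v2 r), 0 < v r &
        v2 r + (N%:R - 1) * (v1 r / r) = lambda * r `^ alpha / v r `^ p + F].
Proof.
move=> N2 [_ _ upos uC2 ueq] uv.
pose i : 'I_N := Ordinal (ltnW N2).
pose x r : 'rV[R]_N := r *: delta_mx 0 i.
have x_neq0 (r : R) : 0 < r -> x r != 0 by exact: axis_neq0.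
have near_gt0 (r : R) : 0 < r -> \forall s \near r, 0 < s.
  by move=> r0; exact: lt_nbhsr.
pose v1 r := partial i u (x r).
pose v2 r := partial i (partial i u) (x r).
have Dv (r : R) : 0 < r -> is_derive r (1 : R) v (v1 r).
  move=> r0; have [_ [du _]] := uC2 _ (x_neq0 r r0).
  have := @is_derive_line R _ u 0 (delta_mx 0 i) r; rewrite add0r.
  move=> /(_ (du i).1); apply: near_eq_is_derive.
  by near=> s; rewrite add0r uv enorm_axis//; near: s; exact: near_gt0.
have Dv1 (r : R) : 0 < r -> is_derive r (1 : R) v1 (v2 r).
  move=> r0; have [_ [_ ddu]] := uC2 _ (x_neq0 r r0).
  have := @is_derive_line R _ (partial i u) 0 (delta_mx 0 i) r; rewrite add0r.
  move=> /(_ (ddu i i).1); apply: near_eq_is_derive.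
  by near=> s; rewrite add0r.
exists v1, v2 => r r0; split; [exact: Dv|exact: Dv1| |].
  by rewrite -[r in v r](enorm_axis i)// -uv; apply/upos/x_neq0.
have := ueq _ (x_neq0 r r0); rewrite uv enorm_axis// => <-.
rewrite /laplacian (bigD1 i)//=; congr (_ + _).
rewrite (eq_bigr (fun=> v1 r / r)); last first.
  move=> j ji; apply: (@radial_transverse R N u v v1 v2 i j r) => //.
  - by move=> y /uC2[_ [du _]]; have [] := du j.
  - by rewrite eq_sym.
  - by have [_ [_ ddu]] := uC2 _ (x_neq0 r r0); have [] := ddu j j.
rewrite sumr_const -[RHS]mulr_natl; congr (_ * _).
by rewrite cardC1 card_ord -subn1 natrB// ltnW.
Unshelve. all: by end_near. Qed.

(** * Emden-Fowler variables *)

(** The first and zeroth order coefficients are those for which the left-hand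
    side is [e^((2 - m) t)] times the radial operator, and [2 - m = rho].  The
    powers of [e^t] in the singular term cancel since [m (p + 1) = alpha + 2]. *)
Lemma emden_fowler (R : realType) (lambda alpha p F n : R) (v v1 v2 : R -> R) :
  0 < p ->
  let m := (alpha + 2) / (p + 1) in
  let rho := (2 * p - alpha) / (p + 1) in
  (forall r : R, 0 < r ->
    [/\ is_derive r (1 : R) v (v1 r), is_derive r (1 : R) v1 (v2 r), 0 < v r &
        v2 r + (n - 1) * (v1 r / r) = lambda * r `^ alpha / v r `^ p + F]) ->
  let w t := expR t `^ (- m) * v (expR t) in
  exists w1 w2 : R -> R, forall t : R,
    [/\ is_derive t (1 : R) w (w1 t), is_derive t (1 : R) w1 (w2 t), 0 < w t &
        w2 t + (2 * m + n - 2) * w1 t + m * (m + n - 2) * w t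
        = lambda * w t `^ (- p) + F * expR (rho * t)].
Proof.
move=> p0 m rho ode w.
have p1 : p + 1 != 0 by rewrite gt_eqF// ltr_wpDl// ltW.
pose e t := expR (- m * t).
have wE : w = (fun t => e t * v (expR t)).
  by apply/funext => t; rewrite /w /e (mulrC (- m)) expRM.
pose w1 t := e t * (- m * v (expR t) + expR t * v1 (expR t)).
pose w2 t := e t * (m ^+ 2 * v (expR t) + (1 - 2 * m) * (expR t * v1 (expR t))
                    + expR t ^+ 2 * v2 (expR t)).
exists w1, w2 => t.
have [Dv Dv1 v0 eq_v] := ode _ (expR_gt0 t).
have De := is_derive_expRM (- m) t.
have Dvt : is_derive t (1 : R) (fun t => v (expR t)) (v1 (expR t) * expR t).
  exact: (@is_derive1_comp R v expR t _ _ Dv (is_derive_expR t)).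
have Dv1t : is_derive t (1 : R) (fun t => v1 (expR t)) (v2 (expR t) * expR t).
  exact: (@is_derive1_comp R v1 expR t _ _ Dv1 (is_derive_expR t)).
have w0 : 0 < w t by rewrite wE mulr_gt0 ?expR_gt0.
split=> //.
- by rewrite wE; apply: is_derive_eq; rewrite /w1 /e /GRing.scale /=; ring.
- by apply: is_derive_eq; rewrite /w2 /e /GRing.scale /=; ring.
have vw : v (expR t) = expR t `^ m * w t.
  by rewrite /w powRN mulrA mulfV ?mul1r// gt_eqF// powR_gt0 ?expR_gt0.
have -> : w2 t + (2 * m + n - 2) * w1 t + m * (m + n - 2) * w t
    = e t * expR t ^+ 2 * (v2 (expR t) + (n - 1) * (v1 (expR t) / expR t)).
  by rewrite wE /w1 /w2 /=; field; rewrite gt_eqF ?expR_gt0.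
rewrite eq_v vw powRM ?powR_ge0 ?(ltW w0)// -powRrM -!expRM powRN.
have e2 : e t * expR t ^+ 2 = expR (rho * t).
  rewrite /e -expRM_natl -expRD; congr expR; rewrite /rho /m.
  by field.
rewrite e2 mulrDr [_ * F]mulrC; congr (_ + _).
rewrite invfM !mulrA; congr (_ / _).
rewrite -expRN mulrAC [_ * lambda]mulrC -!mulrA -!expRD.
rewrite (_ : _ + _ = 0) ?expR0 ?mulr1//.
by rewrite /rho /m; field.
Qed.

Lemma scaled_equation (R : realType) (lambda b p F Lambda a q w w1 w2 X : R) :
  0 < Lambda -> 0 < w -> lambda * Lambda `^ (- p) = b * Lambda ->
  q = (p + 1) * b ->
  w2 + a * w1 + b * w = lambda * w `^ (- p) + F * X ->
  w2 / Lambda + a * (w1 / Lambda) + q * (w / Lambda - 1)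
  = b * powR_remainder p (w / Lambda - 1) + F / Lambda * X.
Proof.
move=> L0 w0 LE -> eqw.
have Ln : Lambda != 0 by exact: lt0r_neq0.
have -> : w2 = lambda * w `^ (- p) + F * X - a * w1 - b * w.
  by rewrite -eqw; ring.
have -> : w `^ (- p) = Lambda `^ (- p) * (w / Lambda) `^ (- p).
  by rewrite -powRM ?(ltW L0) ?divr_ge0 ?ltW// mulrC divfK.
rewrite /powR_remainder (addrC 1) subrK mulrA LE.
by field.
Qed.

(** This says that [Lambda r^m] solves the radial equation for [F = 0]; it makes
    the constant terms cancel in [scaled_equation]. *)
Lemma Lambda_balance (R : realType) (lambda b p : R) :
  0 < lambda -> 0 < b -> 0 < p ->
  let Lambda := (lambda / b) `^ (1 / (p + 1)) in
  lambda * Lambda `^ (- p) = b * Lambda.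
Proof.
move=> l0 b0 p0 Lambda.
have p1 : 0 < p + 1 by lra.
have L0 : 0 < Lambda by rewrite powR_gt0// divr_gt0.
have Lp : Lambda `^ p * Lambda = lambda / b.
  rewrite -[X in _ * X]powRr1 ?(ltW L0)// -powRD; last by rewrite gt_eqF.
  by rewrite -powRrM mul1r mulVf ?powRr1 ?gt_eqF// divr_ge0// ltW.
have -> : lambda = b * (Lambda `^ p * Lambda) by rewrite Lp; field; rewrite gt_eqF.
by rewrite powRN; field; rewrite gt_eqF// powR_gt0.
Qed.


Unset Implicit Arguments.
Set Strict Implicit.

Theorem theorem2p1 (R : realType) (N : nat) (lambda p alpha F : R)
    (u : 'rV[R]_N -> R) (v : R -> R) :
  (2 <= N)%N -> 0 < lambda -> 0 < p -> -2 < alpha -> F != 0 ->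
  rupture_solution lambda alpha p F u ->
  (forall x : 'rV[R]_N, u x = v (enorm x)) ->
  let m := (alpha + 2) / (p + 1) in
  let Lambda := (lambda / (m * (m + N%:R - 2))) `^ (1 / (p + 1)) in
  (exists2 eps : R, 0 < eps &
    exists2 h : R -> R, h =O_ (0^'+) (fun r : R => r `^ eps) &
      \forall r \near 0^'+, v r = Lambda * r `^ m * (1 + h r)) ->
  let z := fun t : R => expR t `^ (- m) * v (expR t) - Lambda in
  let rho := (2 * p - alpha) / (p + 1) in
  exists c : nat -> R, \forall k \near \oo,
    z = (fun t : R => \sum_(1 <= l < k.+1) c l * expR (l%:R * rho * t))
        +O_ (-oo) (fun t : R => expR (k.+1%:R * rho * t)).
Proof.
move=> N2 lambda0 p0 alpha2 F0 rup uv m Lambda [eps eps0 [h hO vE]] z rho.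
have [v1 [v2 ode]] := radial_ode N2 rup uv.
have [w1 [w2 odew]] := emden_fowler p0 ode.
move: odew; rewrite -/m -/rho; set w := fun t => _ => odew.
pose a := 2 * m + N%:R - 2.
pose b := m * (m + N%:R - 2).
pose q := (p + 1) * b.
have p1 : 0 < p + 1 by lra.
have m0 : 0 < m by rewrite divr_gt0//; lra.
have N2R : 2 <= N%:R :> R by rewrite ler_nat.
have a0 : 0 < a by rewrite /a; lra.
have b0 : 0 < b by rewrite mulr_gt0//; lra.
have q0 : 0 < q by rewrite mulr_gt0.
have L0 : 0 < Lambda by rewrite powR_gt0// divr_gt0.
pose y t := w t / Lambda - 1.
pose y1 t := w1 t / Lambda.
pose y2 t := w2 t / Lambda.
have Dy (t : R) : is_derive t (1 : R) y (y1 t).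
  have [Dw _ _ _] := odew t.
  by apply: is_derive_eq; rewrite /y1 /GRing.scale /=; ring.
have Dy1 (t : R) : is_derive t (1 : R) y1 (y2 t).
  have [_ Dw _ _] := odew t.
  by apply: is_derive_eq; rewrite /y2 /GRing.scale /=; ring.
have odey t : y2 t + a * y1 t + q * y t
    = b * powR_remainder p (y t) + F / Lambda * expR (rho * t).
  have [_ _ w0 eqw] := odew t.
  apply: scaled_equation eqw => //.
  exact: (Lambda_balance lambda0 b0 p0).
have y_small (e : R) : 0 < e -> \forall t \near -oo, `|y t| <= e.
  move=> e0.
  have [C C0 HC] := (eqO_exP _ _ _).1 hO.
  have H : \forall r \near 0^'+, `|r `^ (- m) * v r / Lambda - 1| <= e.
    near=> r.
    have r0 : 0 < r by near: r; exact: nbhs_right_gt.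
    have -> : v r = Lambda * r `^ m * (1 + h r) by near: r.
    rewrite powRN (_ : _ - 1 = h r); last first.
      have rm : r `^ m != 0 by rewrite gt_eqF// powR_gt0.
      have Ln : Lambda != 0 by rewrite gt_eqF.
      move: (r `^ m) rm (Lambda) Ln => X X0 L Ln.
      by field; rewrite X0 Ln.
    have hr : `|h r| <= C * `|r `^ eps| by near: r.
    rewrite (le_trans hr)// (ger0_norm (powR_ge0 _ _)) mulrC -ler_pdivlMr//.
    have -> : e / C = ((e / C) `^ eps^-1) `^ eps.
      by rewrite -powRrM mulVf ?powRr1 ?gt_eqF// divr_ge0// ltW.
    rewrite ge0_ler_powR ?nnegrE ?powR_ge0 ?(ltW r0) ?(ltW eps0)//.
    by near: r; apply: nbhs_right_le; rewrite powR_gt0// divr_gt0.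
  have := near_expR ltr01 H.
  by apply: filterS => t; rewrite mul1r.
have FL : F / Lambda != 0 by rewrite mulf_neq0// invr_eq0 gt_eqF.
have [rho0|rho0] := leP rho 0.
  case: (@no_solution_nonpos_rho R rho a q b (F / Lambda) 0
    (powR_remainder p) y y1 y2) => //.
  - exact: powR_remainder0.
  - exact: powR_remainder_quadratic.
have [|||||c Hc] := @asymptotic_expansion R rho a q b (F / Lambda) 0
    (powR_remainder p) y y1 y2 rho0 a0 q0 => //.
- exact: powR_remainder0.
- exact: powR_remainder_quadratic.
- exact: powR_remainder_taylor.
exists (fun l => Lambda * c l); apply: nearW => k.
apply/eqaddOP/bigO_exP.
have [C HC] := Hc k.
exists (Lambda * (`|C| + 1)); first by rewrite mulr_gt0// ltr_wpDl.
apply: filterS HC => t HC.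
have zE : z t = Lambda * y t.
  rewrite /y mulrBr mulr1 mulrC divfK//; exact: lt0r_neq0.
have sumE : \sum_(1 <= l < k.+1) Lambda * c l * expR (l%:R * rho * t)
            = Lambda * \sum_(1 <= l < k.+1) c l * expR (l%:R * rho * t).
  by rewrite mulr_sumr; apply: eq_bigr => l _; rewrite mulrA.
rewrite -[_ t]/(z t - \sum_(1 <= l < k.+1)
  Lambda * c l * expR (l%:R * rho * t)) zE sumE -mulrBr.
rewrite normrM (gtr0_norm L0) -[leRHS]mulrA ler_pM2l// (ger0_norm (expR_ge0 _)).
rewrite (le_trans HC)// ler_wpM2r ?expR_ge0//.
by rewrite (le_trans (ler_norm C))// lerDl.
Unshelve. all: by end_near. Qed.
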